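(* There is a universal constant $C>0$ such that for every integer $k\ge1$, every $\delta\in(0,1]$, and every finite set $V\subset\mathbb{C}^d$ of distinct points which is a $\delta$-$\mathrm{SG}_k^*$ configuration, we have $\dim(V)\le C\,(k/\delta)^2$.
   Context: Let $V\subset\mathbb{C}^d$ be a set of $n$ distinct points. For points $v_1,\ldots,v_k$, $\mathrm{fl}(v_1,\ldots,v_k)$ denotes their affine span; $v_1,\ldots,v_k$ are independent if $\mathrm{fl}(v_1,\ldots,v_k)$ has (affine) dimension $k-1$. $V$ is a $\delta$-$\mathrm{SG}_k^*$ configuration if for every independent $v_1,\ldots,v_k\in V$ there are at least $\delta n$ points $u\in V$ such that either $u\in\mathrm{fl}(v_1,\ldots,v_k)$, or the $k$-flat $\mathrm{fl}(v_1,\ldots,v_k,u)$ contains a point $w\in V$ outside $\mathrm{fl}(v_1,\ldots,v_k)\cup\{u\}$. $\dim(V)$ is the dimension of the smallest affine subspace containing $V$. *)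

(* Defs.v *)
From mathcomp Require Import all_boot all_order all_algebra finmap.
From mathcomp Require Import reals.
From mathcomp Require Import complex.

Set Implicit Arguments.
Unset Strict Implicit.
Unset Printing Implicit Defensive.

Import Order.TTheory GRing.Theory Num.Theory.
Local Open Scope fset_scope.
Local Open Scope ring_scope.

Section AffineGeometry.
Variables (K : fieldType) (vT : vectType K).

(* The (nonempty) affine subspace flat_base + flat_dir. *)
Record flat := Flat { flat_base : vT; flat_dir : {vspace vT} }.

Definition flat_pred (F : flat) : {pred vT} :=
  [pred x | x - flat_base F \in flat_dir F].

Canonical flat_predType := PredType flat_pred.

Definition fldim (F : flat) : nat := \dim (flat_dir F).

(* The affine span of s, for s nonempty: mem_fl and fl_min say that it is the
   smallest flat containing s, flP that it is the set of affine combinations of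
   s, so the choice of the base point is irrelevant.  fl [::] is the junk value
   {0}. *)
Definition fl (s : seq vT) : flat :=
  Flat (head 0 s) (span [seq x - head 0 s | x <- s]).

Definition independent (k : nat) (v : k.-tuple vT) : bool :=
  fldim (fl v) == k.-1.

Lemma in_flat (F : flat) x : (x \in F) = (x - flat_base F \in flat_dir F).
Proof. by []. Qed.

Lemma mem_fl (s : seq vT) : {subset s <= fl s}.
Proof.
move=> x xs; rewrite in_flat memv_span //.
exact: (map_f (fun y => y - head 0 s)).
Qed.

Lemma fl_min (s : seq vT) (F : flat) :
  s != [::] -> {subset s <= F} -> {subset fl s <= F}.
Proof.
case: s => // p s _ sF x; rewrite in_flat /= => xp.
have pF : p \in F by apply: sF; rewrite mem_head.
have sub : (span [seq (y - p)%R | y <- p :: s] <= flat_dir F)%VS.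
  apply/span_subvP => _ /mapP[y ys ->].
  have := rpredB (sF y ys : _ \in flat_dir F) (pF : _ \in flat_dir F).
  by rewrite opprB addrA subrK.
rewrite in_flat -[x](subrK p) -addrA rpredD //; exact: (subvP sub).
Qed.

Lemma fldim_sub (F G : flat) : {subset F <= G} -> (fldim F <= fldim G)%N.
Proof.
move=> FG; apply/dimvS/subvP => u uF.
have bG : flat_base F \in G by apply: FG; rewrite in_flat subrr mem0v.
have uG : flat_base F + u \in G by apply: FG; rewrite in_flat addrAC subrr add0r.
have := rpredB (uG : _ \in flat_dir G) (bG : _ \in flat_dir G).
by rewrite opprB addrA subrK addrAC subrr add0r.
Qed.

Lemma flP (s : seq vT) (x : vT) : s != [::] ->
  x \in fl s <-> exists c : 'I_(size s) -> K,
    \sum_i c i = 1 /\ x = \sum_i c i *: s`_i.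
Proof.
case: s => // p s _; set t := p :: s; rewrite in_flat /=; split.
  move=> /(coord_span (X := in_tuple [seq y - p | y <- t])) /=.
  set e := in_tuple _; move=> xE; pose a i := coord e i (x - p).
  have sz : size t = size [seq y - p | y <- t] by rewrite size_map.
  pose b (i : 'I_(size t)) := a (cast_ord sz i).
  have bE : x - p = \sum_i b i *: (t`_i - p).
    rewrite xE (reindex (cast_ord sz)) /=; last first.
      by exists (cast_ord (esym sz)) => i _; rewrite ?cast_ordK ?cast_ordKV.
    apply: eq_bigr => i _; congr (_ *: _).
    exact: (nth_map 0 0 (fun y => y - p) (ltn_ord i : (i < size t)%N)).
  have [D DE] : exists D, D = 1 - \sum_i b i by eexists.
  exists (fun i => b i + (i == ord0)%:R * D); split.
    rewrite big_split /= [X in _ + X](bigD1 ord0) //= mul1r [X in D + X]big1.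
      by rewrite addr0 DE addrC subrK.
    by move=> i /negPf ->; rewrite mul0r.
  under eq_bigr do rewrite scalerDl.
  rewrite big_split /= [X in _ + X](bigD1 ord0) //= mul1r.
  rewrite [X in _ + (_ + X)]big1 ?addr0; last first.
    by move=> i /negPf ->; rewrite mul0r scale0r.
  have xE' : x - p = \sum_i b i *: t`_i - (\sum_i b i) *: p.
    by rewrite bE scaler_suml -sumrB; apply: eq_bigr => i _; rewrite scalerBr.
  rewrite -[LHS](subrK p) xE' DE scalerBl scale1r /=.
  by rewrite -addrA [- _ + p]addrC.
case=> c [c1 ->].
have -> : \sum_i c i *: t`_i - p = \sum_i c i *: (t`_i - p).
  under [RHS]eq_bigr do rewrite scalerBr.
  by rewrite sumrB -scaler_suml c1 scale1r.
apply: memv_suml => i _; apply/memvZ/memv_span.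
have it : t`_i \in t by apply: mem_nth; exact: ltn_ord.
exact: (map_f (fun y => y - p) it).
Qed.

End AffineGeometry.

Definition SGstar (R : realType) (d k : nat) (delta : R)
    (V : {fset 'rV[R[i]]_d}) : Prop :=
  forall v : k.-tuple 'rV[R[i]]_d, {subset v <= V} -> independent v ->
    delta * (#|` V|)%:R <=
    (#|` [fset u in V | (u \in fl v) ||
           has (fun w => [&& w \in fl (rcons v u), w \notin fl v & w != u])
               V]|)%:R.

(* Main.v *)
(* Lift the points to vectors (1, x), so that flats become linear subspaces.
   For k = 1 (a linear Sylvester-Gallai configuration of n points spanning
   dimension r, each on rich lines with at least s others), every collinear
   triple gives a linear relation between its three vectors.  Weight the
   triples so that each pair is covered with total weight O(1/s) and each point
   owns total weight 1; matrix scaling then turns the relations b_r into unit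
   vectors whose Gram matrix M = sum_r u_r b_r^H b_r has diagonal close to 1.
   M vanishes on an r-dimensional space, so 1 - M fixes it, whence r is at most
   the squared Frobenius norm of 1 - M, which the pair weights bound by
   O(n/s) + 1.  For general k, take the least j for which every j independent
   points span a flat with at least (j delta/k) n special points.  Some j - 1
   independent points span a flat U with fewer than ((j-1) delta/k) n special
   points.  The non-special points project injectively modulo U, so the
   projection is a linear configuration with s about (delta/k) n. *)
Require Import Defs.
From mathcomp Require Import classical_sets.
From mathcomp Require Import all_boot all_order all_algebra finmap.
From mathcomp Require Import reals.
From mathcomp Require Import complex.
From mathcomp Require Import exp spectral ring lra.

Set Implicit Arguments.
Unset Strict Implicit.
Unset Printing Implicit Defensive.

Import Order.TTheory GRing.Theory Num.Theory.
Local Open Scope fset_scope.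
Local Open Scope ring_scope.

(** * Approximate matrix scaling *)

Lemma approx_min (R : realType) (T : Type) (P : T -> Prop) (f : T -> R) (b e : R) :
  0 < e -> (exists x, P x) -> (forall x, P x -> b <= f x) ->
  exists2 x, P x & forall y, P y -> f x < f y + e.
Proof.
move=> e0 [x0 Px0] fb; pose E : set R := (fun z => exists2 x, P x & z = f x)%classic.
have lb : has_lbound E by exists b => _ [x Px ->]; apply: fb.
have infE : has_inf E by split=> //; exists (f x0); exists x0.
have [_ [x Px ->] ltx] := inf_adherent e0 infE.
exists x => // y Py; apply: (lt_le_trans ltx); rewrite lerD2r.
by apply: ge_inf => //; exists y.
Qed.

(* The error at c is the logarithmic gradient of the potential F below, so an
   approximate minimum of F suffices; a t (kap t) > 0 bounds F from below. *)
Lemma approx_scaling (R : realType) (I T : finType) (a : T -> I -> R)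
    (u : T -> R) (kap : T -> I) (s : R) :
  (forall t i, 0 <= a t i) -> (forall t, 0 < a t (kap t)) ->
  (forall t, 0 <= u t) -> (forall i, \sum_(t | kap t == i) u t = 1) ->
  0 < s -> s <= 2^-1 ->
  exists2 c : I -> R, (forall i, 0 < c i) &
    forall i, `|\sum_t u t * (a t i * c i / \sum_j a t j * c j) - 1| <= 3 * s.
Proof.
move=> a0 ak u0 u1 s0 s2.
pose S (c : I -> R) t := \sum_j a t j * c j.
pose P (c : I -> R) := forall i, 0 < c i.
pose F c := \sum_t u t * ln (S c t) - \sum_i ln (c i).
have Sge c t i : P c -> a t i * c i <= S c t.
  move=> Pc; rewrite /S (bigD1 i) //= lerDl sumr_ge0 // => j _.
  by rewrite mulr_ge0 // ltW.
have Sgt c t : P c -> 0 < S c t.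
  by move=> Pc; apply: lt_le_trans (Sge c t (kap t) Pc); rewrite mulr_gt0.
have Fb c : P c -> \sum_t u t * ln (a t (kap t)) <= F c.
  move=> Pc; rewrite /F lerBrDr.
  have -> : \sum_i ln (c i) = \sum_t u t * ln (c (kap t)).
    rewrite (partition_big kap xpredT) //=; apply: eq_bigr => i _.
    rewrite -[LHS]mul1r -(u1 i) mulr_suml.
    by apply: eq_bigr => t /eqP ->.
  rewrite -big_split /=; apply: ler_sum => t _.
  rewrite -mulrDr -lnM ?posrE //; apply: ler_wpM2l => //.
  by rewrite ler_ln ?posrE ?mulr_gt0 ?Sgt ?Sge.
have s2_gt0 : 0 < s ^+ 2 by rewrite exprn_gt0.
have [c Pc Fc] : exists2 c, P c & forall c', P c' -> F c < F c' + s ^+ 2.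
  by apply: approx_min Fb => //; exists (fun=> 1) => i.
exists c => // i; set g := \sum_t _.
(* Only the coordinate [c i] is multiplied by [z]. The bounds ln (1 + x) <= x and 1 - 1/z <= ln z
   linearise the change of [F], which near-minimality keeps above - s^2. *)
have step z : 0 < z -> - s ^+ 2 < (z - 1) * g + z^-1 - 1.
  move=> z0; pose c' j := if j == i then z * c j else c j.
  have Pc' : P c' by move=> j; rewrite /c'; case: eqP => // _; rewrite mulr_gt0.
  have := Fc _ Pc'.
  have S'E t : S c' t = S c t * (1 + (z - 1) * (a t i * c i / S c t)).
    rewrite mulrDr mulr1 mulrCA [S c t * (_ / _)]mulrC divfK ?gt_eqF ?Sgt //.
    rewrite /S (bigD1 i) //= [in RHS](bigD1 i) //= /c' eqxx.
    rewrite (eq_bigr (fun j => a t j * c j)); last by move=> j /negPf ->.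
    by ring.
  have lnS t : ln (S c' t) <= ln (S c t) + (z - 1) * (a t i * c i / S c t).
    have h : 0 < 1 + (z - 1) * (a t i * c i / S c t).
      by rewrite -(pmulr_rgt0 _ (Sgt c t Pc)) -S'E Sgt.
    rewrite S'E lnM ?posrE ?Sgt // lerD2l le_ln1Dx // -subr_gt0.
    by rewrite opprK addrC.
  have lnc : \sum_j ln (c' j) = ln z + \sum_j ln (c j).
    rewrite (bigD1 i) //= [in RHS](bigD1 i) //= /c' eqxx lnM ?posrE //.
    rewrite addrA; congr (_ + _).
    by apply: eq_bigr => j /negPf ->.
  have lnz : 1 - z^-1 <= ln z.
    have : ln (1 + (z^-1 - 1)) <= z^-1 - 1.
      by rewrite le_ln1Dx // ltrBrDr addrC subrr invr_gt0.
    by rewrite addrC subrK lnV ?posrE // => h; lra.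
  have : \sum_t u t * ln (S c' t) <= \sum_t u t * ln (S c t) + (z - 1) * g.
    rewrite /g mulr_sumr -big_split; apply: ler_sum => t _ /=.
    by rewrite [(z - 1) * _]mulrCA -mulrDr; apply: ler_wpM2l.
  by rewrite /F lnc; lra.
(* The choice z = 1 + s bounds [g] from below and z = 1 - s from above. The slack s^2 and the error
   of expanding 1/z are both second order, so division by [s] leaves at most 3 s; [vm] uses s <=
   1/2. *)
have sp : 0 < 1 + s by lra.
have sm : 0 < 1 - s by lra.
have gp := step _ sp; have gm := step _ sm.
have vp : 1 - s <= (1 + s)^-1 <= 1 - s + s ^+ 2.
  rewrite -[X in _ <= X <= _]mul1r ler_pdivlMr // ler_pdivrMr //.
  by apply/andP; split; nra.
have vm : (1 - s)^-1 <= 1 + s + 2 * s ^+ 2.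
  by rewrite -[X in X <= _]mul1r ler_pdivrMr //; nra.
have g1 : s * (1 - g) <= s * (3 * s) by nra.
have g2 : s * (g - 1) <= s * (3 * s) by nra.
rewrite ler_pM2l // in g1; rewrite ler_pM2l // in g2.
by rewrite ler_norml; apply/andP; split; lra.
Qed.

(** * Rank bounds from Frobenius norms and Gram matrices *)

Lemma CauchySchwarz_sum (K : numDomainType) (I : finType) (P : pred I)
    (u a : I -> K) :
  (forall i, 0 <= u i) -> (forall i, 0 <= a i) ->
  (\sum_(i | P i) u i * a i) ^+ 2 <=
    (\sum_(i | P i) u i) * (\sum_(i | P i) u i * a i ^+ 2).
Proof.
move=> u0 a0.
(* Lagrange's identity: this double sum is twice the difference of the two sides. *)
have h : 0 <= \sum_(i | P i) \sum_(j | P j) u i * u j * (a i - a j) ^+ 2.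
  apply: sumr_ge0 => i _; apply: sumr_ge0 => j _.
  apply: mulr_ge0; first exact: mulr_ge0.
  by rewrite -realEsqr rpredB // realE a0.
have E : \sum_(i | P i) \sum_(j | P j) u i * u j * (a i - a j) ^+ 2 =
  ((\sum_(i | P i) u i) * (\sum_(i | P i) u i * a i ^+ 2)
   - (\sum_(i | P i) u i * a i) ^+ 2) *+ 2.
  have -> : ((\sum_(i | P i) u i) * (\sum_(i | P i) u i * a i ^+ 2)
     - (\sum_(i | P i) u i * a i) ^+ 2) *+ 2 =
     (\sum_(i | P i) u i) * (\sum_(i | P i) u i * a i ^+ 2)
   + (\sum_(i | P i) u i * a i ^+ 2) * (\sum_(i | P i) u i)
     - (\sum_(i | P i) u i * a i) * (\sum_(i | P i) u i * a i) *+ 2.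
    by ring.
  rewrite !big_distrlr /= -big_split /= -sumrMnl -sumrB.
  apply: eq_bigr => i _; rewrite -big_split /= -sumrMnl -sumrB.
  by apply: eq_bigr => j _; ring.
by rewrite E pmulrn_lge0 // subr_ge0 in h.
Qed.

(* Let Q have orthonormal rows spanning the row space of X; then the rank of X
   is tr (Q E^T Q^H), the Frobenius product of E with the projector Q^H Q. *)
Lemma rank_le_frobenius (C : numClosedFieldType) (n p : nat)
    (E : 'M[C]_n) (X : 'M[C]_(n, p)) :
  E *m X = X -> (\rank X)%:R <= \sum_i \sum_j `|E i j| ^+ 2.
Proof.
move=> EX; rewrite -mxrank_tr; set r := \rank _.
pose Q := schmidt (row_base X^T).
have Qu : Q \is unitarymx by rewrite schmidt_unitarymx // rank_leq_col.
have QX : (Q :=: X^T)%MS.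
  exact: eqmx_trans (eqmx_schmidt_free (row_base_free _)) (eq_row_base _).
have QE : Q *m E^T = Q.
  have /submxP[D ->] : (Q <= X^T)%MS by rewrite QX.
  by rewrite -mulmxA -trmx_mul EX.
pose P := (map_mx Num.conj Q^T) *m Q.
have trE : r%:R = \tr (E^T *m P).
  by rewrite /P mulmxA mxtrace_mulC mulmxA QE (unitarymxP Qu) mxtrace1.
have trP : r%:R = \sum_i \sum_j `|P i j| ^+ 2.
  have -> : r%:R = \tr (P *m (map_mx Num.conj P^T)).
    rewrite /P trmx_mul map_mxM trmxCK mulmxA -[_ *m Q *m _]mulmxA.
    by rewrite (unitarymxP Qu) mulmx1 mxtrace_mulC (unitarymxP Qu) mxtrace1.
  rewrite /mxtrace; apply: eq_bigr => i _; rewrite !mxE.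
  by apply: eq_bigr => j _; rewrite !mxE normCK.
(* With |P|^2 = r and both cross terms equal to [r], this squared distance expands to |E|^2 + r -
   2r. *)
have h : 0 <= \sum_i \sum_j `|E i j - (P i j)^*| ^+ 2.
  by apply: sumr_ge0 => i _; apply: sumr_ge0 => j _; rewrite exprn_ge0.
have dE i j : `|E i j - (P i j)^*| ^+ 2 = `|E i j| ^+ 2 + `|P i j| ^+ 2
    - (E i j * P i j + (E i j * P i j)^*).
  by rewrite !normCK rmorphB rmorphM /= conjCK; ring.
have {}trE : r%:R = \sum_i \sum_j E i j * P i j.
  rewrite trE /mxtrace exchange_big /=; apply: eq_bigr => j _.
  by rewrite mxE; apply: eq_bigr => i _; rewrite mxE.
have trEC : r%:R = \sum_i \sum_j (E i j * P i j)^*.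
  rewrite -(rmorph_nat (@Num.conj C) r) /= trE rmorph_sum; apply: eq_bigr => i _.
  by rewrite rmorph_sum.
have : \sum_i \sum_j `|E i j - (P i j)^*| ^+ 2 =
    \sum_i \sum_j `|E i j| ^+ 2 + r%:R - (r%:R + r%:R).
  rewrite {1}trP {1}trE trEC -!big_split -sumrB /=; apply: eq_bigr => i _.
  by rewrite -!big_split -sumrB /=; apply: eq_bigr => j _; rewrite dE.
by move=> E2; rewrite E2 opprD addrA addrK subr_ge0 in h.
Qed.

(** The matrix [B], which writes a basis of [U] in terms of [Y], is a left inverse of the coordinate
    matrix. *)
Lemma dim_span_le_rank_coord (K : fieldType) (vT : vectType K) (n : nat)
    (Y : n.-tuple vT) (U := <<Y>>%VS) :
  (\dim U <= \rank (\matrix_(i < n, k < \dim U) coord (vbasis U) k Y`_i))%N.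
Proof.
set X := \matrix_(i, k) _.
pose B := \matrix_(k < \dim U, i < n) coord Y i (vbasis U)`_k.
suff BX : B *m X = 1%:M by rewrite -[leqLHS](mxrank1 K) -BX mxrankM_maxr.
apply/matrixP => k l; rewrite !mxE.
have : (vbasis U)`_k \in U by rewrite vbasis_mem // mem_nth // size_tuple.
move=> /coord_span/(congr1 (coord (vbasis U) l)).
rewrite linear_sum coord_free ?(basis_free (vbasisP U)) // eq_sym => ->.
by apply: eq_bigr => i _; rewrite !mxE linearZ.
Qed.

(** The weighted Gram matrix [G] of the relations kills the coordinates of [y], so E = 1 - G fixes
    them and its Frobenius norm bounds the dimension. A diagonal entry costs e^2. Off the diagonal,
    Cauchy-Schwarz over the relations meeting both [i] and [j] gives t * W i j, and the entries of
    [W] add up to the total weight because each [b r] is a unit vector. *)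
Lemma gram_rank (C : numClosedFieldType) (I T : finType) (vT : vectType C)
    (u : T -> C) (b : T -> I -> C) (y : I -> vT) (e t : C) :
  (forall r, 0 <= u r) -> (forall r, \sum_i `|b r i| ^+ 2 = 1) ->
  (forall i, `|\sum_r u r * `|b r i| ^+ 2 - 1| <= e) -> 0 <= t ->
  (forall i j, i != j ->
    \sum_(r | (b r i != 0) && (b r j != 0)) u r <= t) ->
  (forall r, u r != 0 -> \sum_i b r i *: y i = 0) ->
  (\dim <<[seq y i | i <- enum I]>>)%:R <= t * \sum_r u r + e ^+ 2 * #|I|%:R.
Proof.
move=> u0 b1 diag t0 offdiag by0.
pose G i j := \sum_r u r * ((b r i)^* * b r j).
pose E : 'M[C]_#|I| :=
  \matrix_(i, j) ((i == j)%:R - G (enum_val i) (enum_val j)).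
pose y_ (i : 'I_#|I|) := y (enum_val i).
pose Y := [tuple y_ i | i < #|I|].
have -> : <<[seq y i | i <- enum I]>>%VS = <<Y>>%VS.
  apply: eq_span => x; apply/mapP/mapP => -[i _ ->].
    by exists (enum_rank i); rewrite ?mem_enum // /y_ enum_rankK.
  by exists (enum_val i); rewrite ?mem_enum.
set U := <<Y>>%VS.
have Yi (i : 'I_#|I|) : Y`_i = y_ i by rewrite -tnth_nth tnth_mktuple.
pose X := \matrix_(i < #|I|, k < \dim U) coord (vbasis U) k Y`_i.
have EX : E *m X = X.
  apply/matrixP => i k; rewrite !mxE.
  have -> : \sum_j E i j * X j k = coord (vbasis U) k (\sum_j E i j *: y_ j).
    by rewrite linear_sum; apply: eq_bigr => j _; rewrite linearZ [X _ _]mxE Yi.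
  rewrite Yi; congr (coord _ k _).
  under eq_bigr do rewrite !mxE scalerBl.
  rewrite sumrB (bigD1 i) //= eqxx scale1r big1 => [|j /negPf ji]; last first.
    by rewrite eq_sym ji scale0r.
  rewrite addr0 -[RHS]subr0; congr (_ - _).
  rewrite -(big_enum_val (fun j => G (enum_val i) j *: y j)) /=.
  under eq_bigr do rewrite scaler_suml.
  rewrite exchange_big big1 //= => r _.
  under eq_bigr do rewrite mulrA -scalerA.
  rewrite -scaler_sumr; case: (eqVneq (u r) 0) => [->|/by0 ->].
    by rewrite mul0r scale0r.
  by rewrite scaler0.
apply: le_trans (_ : (\rank X)%:R <= _).
  by rewrite ler_nat dim_span_le_rank_coord.
apply: le_trans (rank_le_frobenius EX) _.
have sum_enum (F : I -> C) : \sum_(i < #|I|) F (enum_val i) = \sum_i F i.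
  by rewrite -(big_enum_val F).
under eq_bigr => i _ do under eq_bigr => j _ do rewrite mxE -(inj_eq enum_val_inj).
rewrite (sum_enum (fun i => \sum_j `|(i == enum_val j)%:R - G i (enum_val j)| ^+ 2)).
under eq_bigr => i _ do rewrite (sum_enum (fun j => `|(i == j)%:R - G i j| ^+ 2)).
pose W i j := \sum_r u r * (`|b r i| ^+ 2 * `|b r j| ^+ 2).
have W0 i j : 0 <= W i j.
  by apply: sumr_ge0 => r _; rewrite !mulr_ge0 ?exprn_ge0.
have GW i j : i != j -> `|G i j| ^+ 2 <= t * W i j.
  move=> ij; pose P r := (b r i != 0) && (b r j != 0).
  have -> : G i j = \sum_(r | P r) u r * ((b r i)^* * b r j).
    rewrite [RHS]big_mkcond; apply: eq_bigr => r _; rewrite /P.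
    by case: (eqVneq (b r i) 0) => [->|_]; case: (eqVneq (b r j) 0) => [->|_];
      rewrite ?(rmorph0, mul0r, mulr0).
  apply: le_trans (_ : (\sum_(r | P r) `|u r * ((b r i)^* * b r j)|) ^+ 2 <= _).
    by rewrite lerXn2r ?nnegrE ?sumr_ge0 // ler_norm_sum.
  under eq_bigr => r _ do rewrite normrM (ger0_norm (u0 r)) normrM norm_conjC.
  apply: le_trans (CauchySchwarz_sum _ u0 _) _ => [r|]; first exact: mulr_ge0.
  apply: ler_pM; rewrite ?sumr_ge0 //.
  - by move=> r _; rewrite mulr_ge0 ?exprn_ge0 ?mulr_ge0.
  - exact: offdiag.
  - under eq_bigr do rewrite exprMn.
    rewrite /W [leRHS](bigID P) /= lerDl ?sumr_ge0 // => *.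
    by rewrite !mulr_ge0 ?exprn_ge0.
have Gii i : `|1 - G i i| ^+ 2 <= e ^+ 2.
  have e0 : 0 <= e by apply: le_trans (diag i).
  rewrite lerXn2r ?nnegrE // distrC; apply: le_trans (diag i).
  by rewrite /G (eq_bigr (fun r => u r * `|b r i| ^+ 2)) // => r _; rewrite normCKC.
have WE : \sum_i \sum_j W i j = \sum_r u r.
  rewrite (eq_bigr (fun i => \sum_r u r * `|b r i| ^+ 2)).
    rewrite exchange_big; apply: eq_bigr => r _ /=.
    by rewrite -mulr_sumr b1 mulr1.
  move=> i _; rewrite exchange_big; apply: eq_bigr => r _ /=.
  by rewrite -!mulr_sumr b1 mulr1.
rewrite -WE mulr_sumr -sum1_card natr_sum mulr_sumr -big_split /=.
apply: ler_sum => i _; rewrite mulr1 (bigD1 i) //= eqxx addrC lerD ?Gii //.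
rewrite mulr_sumr [leRHS](bigD1 i) //= ler_wpDl ?mulr_ge0 //.
apply: ler_sum => j; rewrite eq_sym => ij.
by rewrite (negPf ij) sub0r normrN GW.
Qed.

(** Matrix scaling applied to |A r i|^2 supplies column factors [c]. Multiplying column [i] by sqrt
    (c i) and normalising each row preserves the supports, and dividing [y i] by sqrt (c i)
    preserves the relations. *)
Lemma design_rank (R : realType) (I T : finType) (vT : vectType R[i])
    (A : T -> I -> R[i]) (u : T -> R) (kap : T -> I) (y : I -> vT) (t : R) :
  (forall r, A r (kap r) != 0) -> (forall r, 0 <= u r) ->
  (forall i, \sum_(r | kap r == i) u r = 1) ->
  (forall r, u r != 0 -> \sum_i A r i *: y i = 0) -> 0 <= t ->
  (forall i j, i != j ->
    \sum_(r | (A r i != 0) && (A r j != 0)) u r <= t) ->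
  (\dim <<[seq y i | i <- enum I]>>)%:R <= t * #|I|%:R + 1.
Proof.
move=> Ak u0 u1 Ay t0 offdiag.
pose a r i := complex.Re (A r i) ^+ 2 + complex.Im (A r i) ^+ 2.
have aE r i : ((a r i)%:C = `|A r i| ^+ 2)%C by rewrite -add_Re2_Im2.
have a0 r i : 0 <= a r i by rewrite addr_ge0 ?sqr_ge0.
have ak r : 0 < a r (kap r) by rewrite -ltcR aE exprn_gt0 // normr_gt0.
pose N : R := #|I|%:R + 1.
have N1 : 1 <= N by rewrite lerDr.
have N0 : 0 < N by apply: lt_le_trans N1.
(* The diagonal error 3 s is then 1/N, so its total contribution #|I| / N^2 is at most the additive
   1. *)
pose s := (3 * N)^-1.
have s0 : 0 < s by rewrite invr_gt0 mulr_gt0.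
have s2 : s <= 2^-1 by rewrite lef_pV2 ?posrE ?mulr_gt0 //; lra.
have [c c0 cP] := approx_scaling a0 ak u0 u1 s0 s2.
pose S r := \sum_j a r j * c j.
have S0 r : 0 < S r.
  rewrite /S (bigD1 (kap r)) //= ltr_pwDl ?mulr_gt0 // sumr_ge0 // => i _.
  by rewrite mulr_ge0 // ltW.
pose b r i := A r i * (Num.sqrt (c i) / Num.sqrt (S r))%:C%C.
pose y' i := ((Num.sqrt (c i))^-1)%:C%C *: y i.
have sc0 i : Num.sqrt (c i) != 0 by rewrite gt_eqF // sqrtr_gt0.
have sS0 r : Num.sqrt (S r) != 0 by rewrite gt_eqF // sqrtr_gt0.
have bE r i : `|b r i| ^+ 2 = (a r i * c i / S r)%:C%C.
  have -> : a r i * c i / S r = a r i * (Num.sqrt (c i) / Num.sqrt (S r)) ^+ 2.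
    by rewrite expr_div_n !sqr_sqrtr ?ltW // mulrA.
  rewrite normrM exprMn -aE [RHS]rmorphM rmorphXn /=; congr (_ * _ ^+ 2).
  by rewrite ger0_norm // ler0c divr_ge0 ?sqrtr_ge0.
have b0 r i : (b r i != 0) = (A r i != 0).
  by rewrite mulf_eq0 negb_or (fmorph_eq0 (real_complex R)) mulf_neq0 ?invr_eq0 ?andbT.
apply: le_trans (_ : (\dim <<[seq y' i | i <- enum I]>>)%:R <= _).
  rewrite ler_nat dimvS //; apply/span_subvP => _ /mapP[i _ ->].
  have -> : y i = (Num.sqrt (c i))%:C%C *: y' i.
    by rewrite scalerA -rmorphM divff // scale1r.
  by rewrite memvZ // memv_span // map_f ?mem_enum.
apply: le_trans (_ : t * (\sum_r u r) + (3 * s) ^+ 2 * #|I|%:R <= _); last first.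
  rewrite (partition_big kap xpredT) //= (eq_bigr (fun=> 1)) // sumr_const.
  have -> : 3 * s = N^-1 by rewrite /s; field; rewrite gt_eqF.
  rewrite lerD2l exprVn ler_pdivrMl ?exprn_gt0 // mulr1.
  by rewrite (le_trans (y := N)) ?lerDl // ler_eXnr.
rewrite -lecR rmorphD (rmorphM _ t) (rmorphM _ (_ ^+ 2)) rmorphXn !rmorph_nat.
rewrite rmorph_sum /=.
have uE (P : pred T) : (\sum_(r | P r) u r)%:C%C = \sum_(r | P r) (u r)%:C%C.
  by rewrite rmorph_sum.
apply: (@gram_rank _ I T vT _ b).
- by move=> r; rewrite ler0c.
- move=> r; under eq_bigr do rewrite bE.
  by rewrite -rmorph_sum -mulr_suml divff ?gt_eqF ?S0.
- move=> i; under eq_bigr do rewrite bE -rmorphM.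
  by rewrite -rmorph_sum -rmorphB normc_def /= expr0n addr0 sqrtr_sqr lecR.
- by rewrite ler0c.
- move=> i j ij; rewrite -uE lecR.
  rewrite (eq_bigl _ _ (fun r => congr2 andb (b0 r i) (b0 r j))).
  exact: offdiag.
- move=> r; rewrite (fmorph_eq0 (real_complex R)) => /Ay Ar.
  rewrite (eq_bigr (fun i => ((Num.sqrt (S r))^-1)%:C%C *: (A r i *: y i))).
    by rewrite -scaler_sumr Ar scaler0.
  move=> i _; rewrite !scalerA /b -mulrA -rmorphM mulrAC divff // mul1r.
  by rewrite mulrC.
Qed.

(** * Linear Sylvester-Gallai configurations *)

Lemma ler_sum_cover (K : numDomainType) (T Q : finType) (P : pred T) (e : Q -> T)
    (f : T -> K) :
  (forall r, 0 <= f r) -> (forall r, P r -> exists q, e q = r) ->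
  \sum_(r | P r) f r <= \sum_q f (e q).
Proof.
move=> f0 cover; rewrite [leRHS](partition_big e xpredT) //=.
rewrite [leRHS](bigID P) /= ler_wpDr ?sumr_ge0 // => [r _|].
  by rewrite sumr_ge0.
apply: ler_sum => r /cover[q <-].
by rewrite (bigD1 q) //= lerDl sumr_ge0.
Qed.

Section Collinear.
Variables (K : fieldType) (vT : vectType K) (I : finType) (y : I -> vT).
Hypothesis y_indep : forall i j, i != j -> y j \notin <[y i]>%VS.

Definition line i j := (<[y i]> + <[y j]>)%VS.

Definition collinear i j l := [&& i != j, i != l, j != l & y l \in line i j].

Lemma lineC i j : line i j = line j i. Proof. exact: addvC. Qed.

Lemma memv_line_l i j : y i \in line i j.
Proof. by rewrite memvE addvSl. Qed.

Lemma memv_line_r i j : y j \in line i j.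
Proof. by rewrite memvE addvSr. Qed.

Lemma collinear_coeff i j l : collinear i j l ->
  exists a b, [/\ a != 0, b != 0 & y l = a *: y i + b *: y j].
Proof.
case/and4P=> ij il jl /memv_addP[_ /vlineP[a ->] [_ /vlineP[b ->] yl]].
exists a, b; split=> //.
  apply: contraNneq (y_indep jl) => a0.
  by rewrite yl a0 scale0r add0r memvZ ?memv_line.
apply: contraNneq (y_indep il) => b0.
by rewrite yl b0 scale0r addr0 memvZ ?memv_line.
Qed.

Lemma collinear_sym12 i j l : collinear i j l = collinear j i l.
Proof. by rewrite /collinear lineC eq_sym; case: eqP => //= _; rewrite andbCA. Qed.

Lemma collinear_line i j l : collinear i j l -> line i l = line i j.
Proof.
move=> T; have [a [b [a0 b0 yl]]] := collinear_coeff T.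
apply/eqP; rewrite eqEsubv !subv_add !addvSl /= -!memvE; apply/andP; split.
  by case/and4P: T.
have -> : y j = b^-1 *: (y l - a *: y i).
  by rewrite yl addrAC subrr add0r scalerA mulVf // scale1r.
by rewrite memvZ // memvB ?memvZ ?memv_line_l ?memv_line_r.
Qed.

Lemma collinear_sym23 i j l : collinear i j l = collinear i l j.
Proof.
by apply/idP/idP => T; rewrite /collinear (collinear_line T) memv_line_r;
  case/and4P: T => -> -> H _; rewrite eq_sym H.
Qed.

(** A noncollinear triple gets the indicator of [i]. This keeps the coefficient at [i] nonzero for
    every triple, so a family of relations can be chosen over all triples at once. *)
Lemma collinear_relation i j l : exists f : I -> K,
  [/\ f i != 0, forall x, f x != 0 -> x \in [:: i; j; l] &
      collinear i j l -> \sum_x f x *: y x = 0].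
Proof.
have delta z : \sum_x (x == z)%:R *: y x = y z.
  rewrite (bigD1 z) //= eqxx scale1r big1 ?addr0 // => x /negPf ->.
  by rewrite scale0r.
case T: (collinear i j l); last first.
  exists (fun x => (x == i)%:R); split=> // [|x].
    by rewrite eqxx oner_eq0.
  by rewrite !inE; case: (x == i) => //=; rewrite eqxx.
have [a [b [a0 b0 yl]]] := collinear_coeff T.
exists (fun x => a * (x == i)%:R + b * (x == j)%:R - (x == l)%:R); split.
- case/and4P: T => /negPf-> /negPf-> _ _.
  by rewrite eqxx mulr0 mulr1 addr0 subr0.
- move=> x; rewrite !inE; case: (x == i); case: (x == j); case: (x == l) => //=.
  by rewrite !mulr0 addr0 subr0 eqxx.
move=> _; under eq_bigr do rewrite scalerBl scalerDl -!scalerA.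
by rewrite sumrB big_split /= -!scaler_sumr !delta yl subrr.
Qed.

Definition line_size i j := #|[set k | y k \in line i j]|.

Lemma card_collinear i j : i != j ->
  #|[set l | collinear i j l]| = (line_size i j).-2.
Proof.
move=> ij; pose A := [set k | y k \in line i j].
have Ai : i \in A by rewrite inE memv_line_l.
have Aj : j \in A :\ i by rewrite !inE eq_sym ij memv_line_r.
rewrite /line_size -/A [in RHS](cardsD1 i) Ai [in RHS](cardsD1 j) Aj /=.
apply: eq_card => l; rewrite !inE /collinear ij [i == l]eq_sym [j == l]eq_sym /=.
by rewrite andbCA.
Qed.


Lemma collinear_line_size i j l : collinear i j l ->
  line_size i l = line_size i j.
Proof. by move=> T; rewrite /line_size (collinear_line T). Qed.

Variable R : realFieldType.

(* The ordered triples on a line with m points get weight 1 / (m - 2), so that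
   every pair of points on the line is covered with total weight 1. *)
Definition weight i j l : R := (collinear i j l)%:R / ((line_size i j).-2)%:R.

Lemma weight_ge0 i j l : 0 <= weight i j l.
Proof. by rewrite divr_ge0. Qed.

Lemma weight_sym12 i j l : weight i j l = weight j i l.
Proof. by rewrite /weight collinear_sym12 /line_size lineC. Qed.

Lemma weight_sym23 i j l : weight i j l = weight i l j.
Proof.
rewrite /weight (collinear_sym23 i l); case T: (collinear i j l) => /=.
  by rewrite (collinear_line_size T).
by rewrite !mul0r.
Qed.

Lemma sum_weight i j : \sum_l weight i j l = [exists l, collinear i j l]%:R.
Proof.
have E : (\sum_l collinear i j l)%N = #|[set l | collinear i j l]|.
  rewrite -sum1_card [RHS]big_mkcond; apply: eq_bigr => l _.
  by rewrite inE; case: collinear.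
rewrite -mulr_suml -natr_sum E.
case: existsP => [[l T]|noT]; last first.
  rewrite eq_card0 ?mul0r // => l; rewrite inE.
  by apply/negP => T; apply: noT; exists l.
have ij : i != j by case/and4P: T.
rewrite -(card_collinear ij) divff // pnatr_eq0 -lt0n.
by apply/card_gt0P; exists l; rewrite inE.
Qed.

Lemma sum_weight_le1 i j : \sum_l weight i j l <= 1.
Proof. by rewrite sum_weight lern1 leq_b1. Qed.

Lemma sum_weight_pair x z :
  \sum_(r : I * I * I | (x \in [:: r.1.1; r.1.2; r.2]) &&
                         (z \in [:: r.1.1; r.1.2; r.2]) && (x != z))
     weight r.1.1 r.1.2 r.2 <= 6.
Proof.
(* There are six ways to place [x] and [z] in an ordered triple. By the symmetries of [weight],
   summing over the free third entry gives at most 1 in each case. *)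
pose e (q : (I + I) + (I + I) + (I + I)) := match q with
  | inl (inl (inl k)) => (x, z, k) | inl (inl (inr k)) => (z, x, k)
  | inl (inr (inl k)) => (x, k, z) | inl (inr (inr k)) => (z, k, x)
  | inr (inl k) => (k, x, z) | inr (inr k) => (k, z, x) end.
apply: le_trans (@ler_sum_cover _ _ _ _ e _ _ _) _.
- by move=> r; apply: weight_ge0.
- move=> [[i j] l] /= /andP[/andP[]]; rewrite !inE.
  case/or3P=> /eqP xE; case/or3P=> /eqP zE; subst; rewrite ?eqxx // => _.
  + by exists (inl (inl (inl l))).
  + by exists (inl (inr (inl j))).
  + by exists (inl (inl (inr l))).
  + by exists (inr (inl i)).
  + by exists (inl (inr (inr j))).
  + by exists (inr (inr i)).
rewrite !big_sumType /= !(addrA, big_split).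
have w3 a b : \sum_k weight a k b <= 1.
  by under eq_bigr do rewrite weight_sym23; apply: sum_weight_le1.
have w1 a b : \sum_k weight k a b <= 1.
  by under eq_bigr do rewrite weight_sym12; apply: w3.
have -> : 6 = 1 + 1 + 1 + 1 + 1 + 1 :> R by ring.
by rewrite !lerD ?sum_weight_le1.
Qed.
End Collinear.

(** Each [j] with a third point on its line through [i] contributes 1 to [S i], hence s <= S i.
    Dividing by [S] gives the triples starting at [i] total weight 1, and lowers the pair bound 6 to
    6 / s. *)
Lemma sg_dim (R : realType) (I : finType) (vT : vectType R[i]) (y : I -> vT)
    (s : R) :
  0 < s -> (forall i j, i != j -> y j \notin <[y i]>%VS) ->
  (forall i, s <= #|[set j | [exists l, collinear y i j l]]|%:R) ->
  (\dim <<[seq y i | i <- enum I]>>)%:R <= 6 / s * #|I|%:R + 1.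
Proof.
move=> s0 yI sle.
pose S i : R := \sum_j \sum_l weight y R i j l.
have Ss i : s <= S i.
  apply: le_trans (sle i) _; rewrite -sum1_card natr_sum big_mkcond /=.
  apply: ler_sum => j _; rewrite sum_weight inE.
  by case: [exists l, _].
have S0 i : 0 < S i by apply: lt_le_trans (Ss i).
pose u (r : I * I * I) := weight y R r.1.1 r.1.2 r.2 / S r.1.1.
have relation (r : I * I * I) := collinear_relation yI r.1.1 r.1.2 r.2.
have [A AP] := fin_all_exists relation.
apply: (@design_rank R I (I * I * I)%type vT A u (fun r => r.1.1)).
- by move=> r; case: (AP r).
- by move=> r; rewrite divr_ge0 ?weight_ge0 // ltW.
- move=> i; have triple (f : I * I * I -> R) :
      \sum_r f r = \sum_x \sum_j \sum_l f (x, j, l).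
    by rewrite !pair_bigA /=; apply: eq_bigr => -[[]].
  rewrite big_mkcond triple (bigD1 i) //= eqxx [X in _ + X]big1 => [|x xi].
    rewrite addr0 /u /=; under eq_bigr do rewrite -mulr_suml.
    by rewrite -mulr_suml divff ?gt_eqF ?S0.
  by apply: big1 => j _; apply: big1 => l _; rewrite (negPf xi).
- move=> r ur; have [_ _ ] := AP r; apply.
  by apply: contraNT ur => /negPf nT; rewrite /u /weight nT !mul0r.
- by rewrite divr_ge0 ?ltW.
move=> x z xz.
apply: le_trans (_ : s^-1 * \sum_(r : I * I * I |
    (x \in [:: r.1.1; r.1.2; r.2]) && (z \in [:: r.1.1; r.1.2; r.2]) && (x != z))
    weight y R r.1.1 r.1.2 r.2 <= _).
  rewrite mulr_sumr big_mkcond [leRHS]big_mkcond; apply: ler_sum => r _ /=.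
  have w0 := weight_ge0 y R r.1.1 r.1.2 r.2; have [_ Ar _] := AP r.
  case: (boolP (_ && _)) => [/andP[/Ar -> /Ar ->]|_]; last first.
    by case: ifP => // _; rewrite mulr_ge0 // invr_ge0 ltW.
  by rewrite xz /u mulrC ler_wpM2r // lef_pV2 ?posrE.
rewrite [6 / s]mulrC ler_wpM2l ?invr_ge0 ?(ltW s0) //.
exact: (sum_weight_pair yI).
Qed.

(** * Special points and projection modulo a subspace *)

Section Quotient.
Variables (K : fieldType) (vT : vectType K) (U : {vspace vT}).

(** The projection along [U] onto a complement; it plays the role of the quotient map while staying
    inside [vT]. *)
Definition quotv : 'End(vT) := (\1 - projv U)%VF.

Lemma quotv_eq0 x : (quotv x == 0) = (x \in U).
Proof.
rewrite /quotv add_lfunE opp_lfunE id_lfunE subr_eq0.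
by apply/eqP/idP => [->|/projv_id]; rewrite ?memv_proj.
Qed.

Lemma lker_quotv : lker quotv = U.
Proof. by apply/vspaceP => x; rewrite memv_ker quotv_eq0. Qed.

Lemma mem_quotv S x : (quotv x \in quotv @: S)%VS = (x \in U + S)%VS.
Proof.
apply/memv_imgP/memv_addP => [[z zS /eqP]|[a aU [b bS ->]]]; last first.
  exists b => //; rewrite linearD /=.
  by have /eqP -> : quotv a == 0; rewrite ?add0r // quotv_eq0.
rewrite -subr_eq0 -linearB quotv_eq0 => xzU.
by exists (x - z) => //; exists z; rewrite ?subrK.
Qed.

Lemma addv_line_eq x z : (x \in U + <[z]>)%VS -> x \notin U ->
  (U + <[x]> = U + <[z]>)%VS.
Proof.
move=> xUz xU; apply/eqP; rewrite eqEsubv !subv_add !addvSl /= -!memvE xUz /=.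
have [a aU [_ /vlineP[c ->] xE]] := memv_addP xUz.
have c0 : c != 0 by apply: contraNneq xU => c0; rewrite xE c0 scale0r addr0.
have -> : z = c^-1 *: (x - a) by rewrite xE addrAC subrr add0r scalerA mulVf ?scale1r.
rewrite memvZ // memvB //; last by rewrite (subvP (addvSl _ _)).
by rewrite (subvP (addvSr _ _)) ?memv_line.
Qed.

End Quotient.

Section Special.
Variables (K : fieldType) (vT : vectType K) (P : finType) (X : P -> vT).

(** The linear form of the points counted in [SGstar], with [U] the span of the lifted flat. *)
Definition special (U : {vspace vT}) : {set P} :=
  [set u | (X u \in U) ||
    [exists w, [&& X w \in (U + <[X u]>)%VS, X w \notin U & w != u]]].

Lemma mem_special U u w : X w \in (U + <[X u]>)%VS -> X w \notin U -> w != u ->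
  u \in special U.
Proof.
by move=> *; rewrite inE; apply/orP; right; apply/existsP; exists w; apply/and3P.
Qed.

(** A canonical point in the class of [u] modulo [U]: the choice depends only on the subspace U +
    <[X u]>. The default is never reached, since [u] itself qualifies. *)
Definition rep (U : {vspace vT}) (u : P) : P :=
  odflt u [pick w | (U + <[X w]> == U + <[X u]>)%VS].

Lemma rep_span U u : (U + <[X (rep U u)]> = U + <[X u]>)%VS.
Proof. by rewrite /rep; case: pickP => [w /eqP|_]. Qed.

Lemma rep_eq U u w : (U + <[X u]> = U + <[X w]>)%VS -> rep U u = rep U w.
Proof.
move=> uw; rewrite /rep uw; case: pickP => //= /(_ w).
by rewrite eqxx.
Qed.

Lemma rep_notin U u : (X (rep U u) \notin U) = (X u \notin U).
Proof.
have E z : (X z \in U) = (U + <[X z]> == U)%VS.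
  by rewrite memvE; apply/addv_idPl/eqP.
by rewrite !E rep_span.
Qed.

(** Another point in the class of [u] would witness that [u] is special. *)
Lemma rep_id U u : u \notin special U -> rep U u = u.
Proof.
move=> uU; apply/eqP; apply: contraNT uU => ru.
case: (boolP (X u \in U)) => Xu; first by rewrite inE Xu.
apply: (mem_special _ _ ru); last by rewrite rep_notin.
by rewrite -rep_span (subvP (addvSr _ _)) ?memv_line.
Qed.

End Special.

(** One representative per class outside [U] gives pairwise independent images modulo [U]. A point
    that becomes special when [v] is added to [U] lies, modulo [U], on a line through [v] with a
    third point, so [sg_dim] applies to the images. *)
Lemma quotient_dim (R : realType) (vT : vectType R[i]) (P : finType)
    (X : P -> vT) (U : {vspace vT}) (s : R) :
  0 < s ->
  (forall v, X v \notin U ->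
    s + 1 + #|special X U|%:R <= #|special X (U + <[X v]>)|%:R) ->
  (\dim <<[seq X u | u <- enum P]>>)%:R <= (\dim U)%:R + 6 / s * #|P|%:R + 1.
Proof.
move=> s0 gap; pose f := quotv U.
pose J : finType := {u : P | (X u \notin U) && (rep X U u == u)}.
pose y (j : J) := f (X (val j)).
have inJ u : X u \notin U ->
    (X (rep X U u) \notin U) && (rep X U (rep X U u) == rep X U u).
  by move=> Xu; rewrite rep_notin Xu; apply/eqP/rep_eq/rep_span.
have yI i j : i != j -> y j \notin <[y i]>%VS.
  apply: contraNN; rewrite -limg_line mem_quotv => XjXi.
  have /andP[Xi /eqP ri] := valP i; have /andP[Xj /eqP rj] := valP j.
  by apply/eqP/val_inj; rewrite -ri -rj; apply: rep_eq; rewrite (addv_line_eq XjXi).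
have lineE i j u : (f (X u) \in line y i j) =
    (X u \in U + <[X (val i)]> + <[X (val j)]>)%VS.
  by rewrite /line -!limg_line -limgD mem_quotv addvA.
have dimy : (\dim <<[seq y j | j <- enum J]>>)%:R <= 6 / s * #|J|%:R + 1.
  apply: sg_dim => // i.
  have /andP[Xi ri] := valP i; set v := val i in Xi ri.
  pose D := [set j : J | (val j \in special X (U + <[X v]>)) &&
    (val j \notin special X U) && (val j != v)].
  apply: le_trans (_ : #|D|%:R <= _).
    (* Points not special for [U] represent themselves, hence belong to [J]. The summand 1 accounts
       for [v]. *)
    have : (#|special X (U + <[X v]>)| <= #|D| + #|special X U| + 1)%N.
      rewrite -(card_imset _ val_inj) -[X in (_ + X)%N](cards1 v).
      apply: leq_trans (leq_add (leq_card_setU _ _) (leqnn _)).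
      apply: leq_trans (leq_card_setU _ _); apply/subset_leq_card/subsetP => u uS.
      rewrite !in_setU in_set1; case: eqVneq => [->|uv]; rewrite ?orbT // orbF.
      case: (boolP (u \in special X U)) => [|uU]; rewrite ?orbT // orbF.
      have Xu : X u \notin U by apply: contraNN uU => Xu; rewrite inE Xu.
      have uJ : (X u \notin U) && (rep X U u == u) by rewrite Xu rep_id /=.
      by apply/imsetP; exists (Sub u uJ); rewrite ?SubK // in_set SubK uS uU uv.
    rewrite -(ler_nat R) !natrD; have := gap v Xi; lra.
  rewrite ler_nat; apply/subset_leq_card/subsetP => j.
  (* If X j were in U + <[X v]>, [v] would make [j] special for [U]. So some [w] outside U + <[X v]>
     is a witness for [j]. Its representative is not [v], and it is not [j], since otherwise [w]
     would make [j] special for [U]. *)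
  rewrite [j \in D]in_set => /andP[/andP[jS jU] jv']; rewrite in_set.
  move: jS; rewrite in_set => /orP[jv|/existsP[w /and3P[wjv wv wj]]].
    have /andP[Xj _] := valP j.
    case/negP: jU; apply: (mem_special (w := v)) => //; last by rewrite eq_sym.
    by rewrite (addv_line_eq jv Xj) (subvP (addvSr _ _)) ?memv_line.
  have /andP[Xj _] := valP j.
  have Xw : X w \notin U by apply: contraNN wv; apply/subvP/addvSl.
  apply/existsP; exists (Sub (rep X U w) (inJ w Xw)).
  have rwE := rep_span X U w.
  apply/and4P; split.
  - by rewrite eq_sym -(inj_eq val_inj).
  - rewrite -(inj_eq val_inj) SubK; apply: contraNneq wv => vw.
    by rewrite (vw : v = _) rwE (subvP (addvSr _ _)) ?memv_line.
  - rewrite -(inj_eq val_inj) SubK; apply: contraNneq jU => jw.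
    by apply: (mem_special _ Xw wj); rewrite jw rwE (subvP (addvSr _ _)) ?memv_line.
  rewrite lineE SubK -/v; apply: subvP (_ : X (rep X U w) \in U + <[X w]>)%VS.
    by rewrite subv_add -memvE wjv (subv_trans (addvSl _ <[X v]>)) ?addvSl.
  by rewrite -rwE (subvP (addvSr _ _)) ?memv_line.
have cardJ : (#|J| <= #|P|)%N by rewrite card_sub max_card.
have dimX : (\dim <<[seq X u | u <- enum P]>> <=
    \dim U + \dim <<[seq y j | j <- enum J]>>)%N.
  rewrite -(limg_ker_dim f <<[seq X u | u <- enum P]>>) lker_quotv.
  rewrite leq_add ?dimvS ?capvSr // limg_span.
  apply/span_subvP => _ /mapP[_ /mapP[u _ ->] ->].
  case: (boolP (X u \in U)) => [|Xu].
    by rewrite -quotv_eq0 => /eqP ->; rewrite mem0v.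
  have : f (X u) \in <[y (Sub (rep X U u) (inJ u Xu))]>%VS.
    by rewrite -limg_line mem_quotv SubK rep_span (subvP (addvSr _ _)) ?memv_line.
  by apply/subvP; rewrite -memvE memv_span // map_f ?mem_enum.
apply: le_trans (_ : (\dim U)%:R + (6 / s * #|J|%:R + 1) <= _).
  by apply: le_trans (lerD (lexx _) dimy); rewrite -natrD ler_nat.
by rewrite -addrA !lerD // ler_wpM2l ?divr_ge0 ?(ltW s0) ?ler_nat.
Qed.

(** * Homogeneous coordinates *)

Section Lift.
Variables (K : fieldType) (d : nat).
Implicit Types (s : seq 'rV[K]_d) (x p : 'rV[K]_d).

Definition lift1 x : 'rV[K]_(1 + d) := row_mx 1 x.

Lemma lift1_neq0 x : lift1 x != 0.
Proof. by rewrite row_mx_eq0 oner_eq0. Qed.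

Definition at_infinity : 'Hom('rV[K]_d, 'rV[K]_(1 + d)) :=
  linfun (mulmxr (row_mx 0 1%:M)).

Lemma at_infinityE x : at_infinity x = row_mx 0 x.
Proof. by rewrite lfunE /= mul_mx_row mulmx0 mulmx1. Qed.

Lemma lift1D p x : lift1 (p + x) = lift1 p + at_infinity x.
Proof. by rewrite at_infinityE add_row_mx addr0. Qed.

(** Comparing first coordinates forces the coefficient of [lift1 p] to be 1. *)
Lemma mem_lift1 p (D : {vspace 'rV[K]_d}) x :
  (lift1 x \in <[lift1 p]> + at_infinity @: D)%VS = (x - p \in D).
Proof.
apply/memv_addP/idP => [[_ /vlineP[c ->] [_ /memv_imgP[v vD ->]]]|xpD].
  rewrite at_infinityE scale_row_mx add_row_mx => /eq_row_mx[].
  rewrite addr0 => /matrixP/(_ 0 0); rewrite !mxE eqxx mulr1 => <-.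
  by rewrite scale1r => ->; rewrite addrAC subrr add0r.
exists (lift1 p); first exact: memv_line.
exists (at_infinity (x - p)); first exact: memv_img.
by rewrite -lift1D addrC subrK.
Qed.

Lemma span_lift1 s : s != [::] ->
  <<map lift1 s>>%VS = (<[lift1 (head 0%R s)]> + at_infinity @: flat_dir (fl s))%VS.
Proof.
case: s => // p s _; set t := p :: s; rewrite -[head _ _]/p.
apply/eqP; rewrite eqEsubv.
apply/andP; split.
  apply/span_subvP => _ /mapP[x xt ->]; rewrite mem_lift1.
  exact: (mem_fl xt).
have tS x : x \in t -> lift1 x \in <<map lift1 t>>%VS.
  by move=> xt; rewrite memv_span // map_f.
have -> : flat_dir (fl t) = <<[seq x - p | x <- t]>>%VS by [].
rewrite subv_add -memvE tS ?mem_head // limg_span.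
apply/span_subvP => _ /mapP[_ /mapP[x xt ->] ->].
have -> : at_infinity (x - p) = lift1 x - lift1 p.
  by rewrite -{2}[x](subrK p) [x - p + p]addrC lift1D addrAC subrr add0r.
by rewrite memvB ?tS ?mem_head.
Qed.

Lemma mem_fl_lift1 s x : s != [::] ->
  (x \in fl s) = (lift1 x \in <<map lift1 s>>%VS).
Proof. by move=> s0; rewrite span_lift1 // mem_lift1. Qed.

(** The lifted base point has first coordinate 1, so it adds one dimension to the directions, which
    lie at infinity. *)
Lemma fldim_lift1 s : s != [::] -> \dim <<map lift1 s>> = (fldim (fl s)).+1.
Proof.
move=> s0; rewrite span_lift1 // dimv_disjoint_sum.
  rewrite dim_vline limg_dim_eq /fldim; last first.
    apply/eqP; rewrite -subv0; apply/subvP => x; rewrite memv_cap memv_ker memv0.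
    by rewrite at_infinityE row_mx_eq0 => /and3P[].
  by rewrite lift1_neq0.
apply/eqP; rewrite -subv0; apply/subvP => x.
rewrite memv_cap memv0 => /andP[/vlineP[c ->] /memv_imgP[v _]].
rewrite at_infinityE scale_row_mx => /eq_row_mx[/matrixP/(_ 0 0)].
by rewrite !mxE mulr1 => -> _; rewrite !scale0r row_mx0.
Qed.

Lemma lift1_indep x p : x != p -> lift1 p \notin <[lift1 x]>%VS.
Proof.
apply: contraNN => /vlineP[c]; rewrite scale_row_mx => /eq_row_mx[].
by move=> /matrixP/(_ 0 0); rewrite !mxE mulr1 => <- ->; rewrite scale1r.
Qed.

End Lift.

(** * Descent on the number of spanning points, and the conclusion *)

Lemma special_dim (R : realType) (vT : vectType R[i]) (P : finType)
    (X : P -> vT) (k : nat) (delta : R) :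
  (0 < k)%N -> 0 < delta -> delta <= 1 -> (forall u, X u != 0) ->
  (forall u w, u != w -> X w \notin <[X u]>%VS) ->
  (forall v : k.-tuple P, free (map X v) ->
    delta * #|P|%:R <= #|special X <<map X v>>|%:R) ->
  (\dim <<[seq X u | u <- enum P]>>)%:R <= 14 * (k%:R / delta).
Proof.
move=> k0 d0 d1 X0 XI Xk.
pose n : R := #|P|%:R; pose g := delta / k%:R * n.
have kR : 1 <= k%:R :> R by rewrite ler1n.
have kR0 : 0 < k%:R :> R by rewrite ltr0n.
have kd : k%:R <= k%:R / delta by rewrite ler_peMr ?invf_ge1 // ltW.
have nE : n = k%:R / delta * g by rewrite /g; field; rewrite !gt_eqF.
have kd0 : 0 < k%:R / delta by rewrite divr_gt0.
have project U : (\dim U <= k)%N ->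
    (forall v, X v \notin U ->
      g + #|special X U|%:R <= #|special X (U + <[X v]>)|%:R) ->
    (\dim <<[seq X u | u <- enum P]>>)%:R <= 14 * (k%:R / delta).
  move=> Uk gap; case: (lerP g 2) => g2.
    apply: le_trans (_ : n <= _).
      by rewrite ler_nat (leq_trans (dim_span _)) // size_map -cardE.
    by rewrite nE [leRHS]mulrC ler_wpM2l ?(ltW kd0) //; lra.
  have s0 : 0 < g - 1 by lra.
  apply: le_trans (quotient_dim (U := U) s0 _) _ => [v /gap|]; first by lra.
  have UkR : (\dim U)%:R <= k%:R :> R by rewrite ler_nat.
  have : 6 / (g - 1) * n <= 12 * (k%:R / delta).
    rewrite nE mulrA [6 / _ * _]mulrC -mulrA [leRHS]mulrC ler_wpM2l ?(ltW kd0) //.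
    by rewrite mulrAC ler_pdivrMr //; lra.
  by rewrite -/n; lra.
pose Q j := [forall v : j.-tuple P, free (map X v) ==>
  (j%:R * g <= #|special X <<map X v>>|%:R)].
suff descent j : (j < k)%N -> Q j.+1 ->
    (\dim <<[seq X u | u <- enum P]>>)%:R <= 14 * (k%:R / delta).
  apply: (descent k.-1); rewrite prednK //; apply/forallP => v; apply/implyP => /Xk.
  by rewrite (_ : k%:R * g = delta * n) // /g; field; rewrite gt_eqF.
elim: j => [|j IH] jk /forallP Qj.
  apply: (@project 0%VS) => [|v _]; first by rewrite dimv0.
  have -> : special X 0 = set0.
    apply/setP => u; rewrite !inE memv0 (negPf (X0 u)) /=.
    apply/existsP => -[w /and3P[]]; rewrite add0v => wu _ w_u.
    by have := XI u w; rewrite eq_sym w_u wu => /(_ isT).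
  have /implyP := Qj [tuple v]; rewrite cards0 add0v /= span_seq1 mul1r addr0; apply.
  by rewrite seq1_free X0.
case: (boolP (Q j.+1)) => [/(IH (ltnW jk)) //|].
rewrite negb_forall => /existsP[v]; rewrite negb_imply -ltNge => /andP[vfree vlt].
apply: (@project <<map X v>>%VS) => [|w wU].
  by rewrite (leq_trans (dim_span _)) // size_map size_tuple ltnW.
have /implyP := Qj [tuple of w :: v].
rewrite /= free_cons wU vfree span_cons addvC => /(_ isT).
by move=> h; apply: le_trans h; rewrite [j.+2%:R]mulrSr mulrDl mul1r addrC lerD2r ltW.
Qed.

Theorem theorem5p3 (R : realType) :
  exists C : R, 0 < C /\
    forall (k d : nat) (delta : R) (V : {fset 'rV[R[i]]_d}),
      (1 <= k)%N -> 0 < delta -> delta <= 1 ->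
      SGstar k delta V ->
      (fldim (fl V))%:R <= C * (k%:R / delta) ^+ 2.
Proof.
exists 14; split=> // k d delta V k0 d0 d1 sgV.
have kd : 1 <= k%:R / delta.
  by rewrite ler_pdivlMr // mul1r (le_trans d1) // ler1n.
have bound0 : 0 <= 14 * (k%:R / delta) ^+ 2 by rewrite mulr_ge0 ?sqr_ge0.
case: (eqVneq (V : seq _) [::]) => [->|V0].
  by rewrite /fldim /= span_nil dimv0.
pose P : finType := V; pose X (u : P) := lift1 (val u).
have XV s : map X s = map (@lift1 _ d) (map val s) by rewrite -map_comp.
have := @special_dim R _ P X k delta k0 d0 d1.
have -> : <<[seq X u | u <- enum P]>>%VS = <<map (@lift1 _ d) V>>%VS.
  apply: eq_span => x; apply/mapP/mapP => -[u uV ->].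
    by exists (val u) => //; apply: valP.
  by exists [` uV] => //; rewrite mem_enum.
rewrite fldim_lift1 // => bound.
apply: le_trans (_ : (fldim (fl V)).+1%:R <= _); first by rewrite ler_nat.
apply: le_trans (bound _ _ _) _ => [u|u w uw|v vfree|].
- exact: lift1_neq0.
- exact: lift1_indep.
- have v0 : map val v != [::] by rewrite -size_eq0 size_map size_tuple -lt0n.
  have vind : independent [tuple of map val v].
    rewrite /independent -eqSS prednK //= -(fldim_lift1 v0) -XV.
    by move: vfree; rewrite /free size_map size_tuple.
  have vV : {subset [tuple of map val v] <= V} by move=> _ /mapP[u _ ->]; apply: valP.
  have := sgV [tuple of map val v] vV vind; rewrite -cardfE => /le_trans; apply.
  rewrite ler_nat.
  pose S := special X <<map X v>>.
  have cardS : (#|` [fset val u | u in S]| <= #|S|)%N.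
    by rewrite [leqRHS]cardE leq_imfset_card.
  apply: leq_trans cardS.
  apply/fsubset_leq_card/fsubsetP => u; rewrite !inE /= => /andP[uV us].
  apply/imfsetP; exists [` uV] => //=; rewrite inE XV.
  case/orP: us => [uv|/hasP[w wV /and3P[wvu wv wu]]].
    by apply/orP; left; rewrite -mem_fl_lift1.
  apply/orP; right; apply/existsP; exists [` wV]; apply/and3P; split=> //=.
  - move: wvu; rewrite mem_fl_lift1 ?map_rcons; last by rewrite -size_eq0 size_rcons.
    by rewrite -cats1 span_cat span_seq1.
  - by rewrite -mem_fl_lift1.
by rewrite ler_wpM2l // ler_eXnr.
Qed.
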